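(* Let $\alpha_1,\alpha_2\in[0,\pi/2)$, let $X=[x_{ij}]\in\mathbb{M}^s_{n,\alpha_1}$ and $Y=[y_{ij}]\in\mathbb{M}^s_{n,\alpha_2}$. Then $$\omega(X\circ Y)\le\sec(\alpha_1)\sec(\alpha_2)\,\min\left\{\max_j|x_{jj}|\;\omega(Y),\ \max_j|y_{jj}|\;\omega(X)\right\}.$$
   Context: $\mathbb{M}_n$ is the algebra of all $n\times n$ complex matrices. For $X=[x_{ij}],Y=[y_{ij}]\in\mathbb{M}_n$ the Hadamard product is $X\circ Y=[x_{ij}y_{ij}]$. The numerical range of $X\in\mathbb{M}_n$ is $W(X)=\{\langle Xx,x\rangle : x\in\mathbb{C}^n,\ \|x\|=1\}$, with the standard inner product and Euclidean norm on $\mathbb{C}^n$, and the numerical radius is $\omega(X)=\sup\{|z| : z\in W(X)\}$. For $\alpha\in[0,\pi/2)$ let $S_\alpha=\{z\in\mathbb{C} : \operatorname{Re}(z)>0,\ |\operatorname{Im}(z)|\le\tan(\alpha)\operatorname{Re}(z)\}$, and let $\mathbb{M}^s_{n,\alpha}$ be the class of all $X\in\mathbb{M}_n$ such that $W(zX)\subset S_\alpha$ for some $z\in\mathbb{C}$ with $|z|=1$. *)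

(* Defs.v *)
From mathcomp Require Import all_boot all_order all_algebra.
From mathcomp Require Import classical_sets reals trigo.
From mathcomp Require Export complex.

Set Implicit Arguments.
Unset Strict Implicit.
Unset Printing Implicit Defensive.

Import Order.TTheory GRing.Theory Num.Theory.

Local Open Scope classical_set_scope.
Local Open Scope ring_scope.
Local Open Scope complex_scope.

(* The canonical norm [`|z|] of [R[i]] takes its values in [R[i]]; [cmod] is
   the modulus as an element of [R]. *)
Notation cmod := Normc.normc.

Section NumericalRadius.
Context {R : realType}.

Definition sec (a : R) : R := (cos a)^-1.

Definition hadamard n (X Y : 'M[R[i]]_n) : 'M[R[i]]_n :=
  map2_mx *%R X Y.

Definition inner n (u v : 'cV[R[i]]_n) : R[i] :=
  \sum_(i < n) u i 0 * (v i 0)^*.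

Definition enorm n (u : 'cV[R[i]]_n) : R :=
  Num.sqrt (\sum_(i < n) cmod (u i 0) ^+ 2).

Definition numrange n (X : 'M[R[i]]_n) : set R[i] :=
  [set z | exists2 x : 'cV[R[i]]_n, enorm x = 1 & z = inner (X *m x) x].

(* [sup] is the least upper bound in [R] of a nonempty bounded set, and 0 on
   other sets; the numerical range is bounded, and nonempty when [0 < n]. *)
Definition numradius n (X : 'M[R[i]]_n) : R :=
  sup [set cmod z | z in numrange X].

Definition sector (a : R) : set R[i] :=
  [set z | 0 < complex.Re z /\ `|complex.Im z| <= tan a * complex.Re z].

Definition sectorial n (a : R) : set 'M[R[i]]_n :=
  [set X | exists2 z : R[i], cmod z = 1 & numrange (z *: X) `<=` sector a].

(* The unit 0 of the iterated maximum is harmless: all the terms are moduli. *)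
Definition maxdiag n (X : 'M[R[i]]_n) : R :=
  \big[Num.max/0]_(j < n) cmod (X j j).

End NumericalRadius.

Arguments sectorial {R} n a.

(* Main.v *)
(* A sectorial [X], rotated so that [W(X)] lies in the sector, is congruent to a
   diagonal matrix: [X = T^* diag(d) T], where each [d_k] is a value of the
   quadratic form of [X], hence [|d_k| <= sec(a) Re d_k]. Then
     <(X o Y) x, x> = sum_k d_k <Y u_k, u_k>,  u_k := (k-th row of T) o x,
   is bounded by sec(a) w(Y) sum_j Re(x_jj) |x_j|^2. This needs a single secant
   factor; the other one is at least 1. *)
Require Import Defs.
From mathcomp Require Import all_boot all_order all_algebra.
From mathcomp Require Import classical_sets reals trigo.
From mathcomp Require Import spectral ring.
Local Open Scope ring_scope.

Set Implicit Arguments.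
Unset Strict Implicit.
Unset Printing Implicit Defensive.

Import Order.TTheory GRing.Theory Num.Theory.

Local Open Scope sesquilinear_scope.

(** * Congruence to a diagonal matrix *)

Section Congruence.
Context {C : numClosedFieldType}.

Lemma trmxC_mul m n p (A : 'M[C]_(m, n)) (B : 'M[C]_(n, p)) :
  (A *m B)^t* = B^t* *m A^t*.
Proof. by rewrite trmx_mul map_mxM. Qed.

Lemma trmxCD m n (A B : 'M[C]_(m, n)) : (A + B)^t* = A^t* + B^t*.
Proof. by apply/matrixP=> i j; rewrite !mxE rmorphD. Qed.

Lemma trmxC1 n : (1%:M : 'M[C]_n)^t* = 1%:M.
Proof. by rewrite trmx1 map_mx1. Qed.

Lemma mulmx_diagE n p (A : 'M[C]_(n, p)) (d : 'rV[C]_n) i j :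
  (A^t* *m diag_mx d *m A) i j = \sum_k d 0 k * A k j * (A k i)^*.
Proof.
rewrite mxE; apply: eq_bigr => k _.
by rewrite mul_mx_diag !mxE mulrC (mulrC _ (d 0 k)) mulrA [_ * d 0 k]mulrC.
Qed.

Lemma trmxC_diag n (d : 'rV[C]_n) : (diag_mx d)^t* = diag_mx (map_mx Num.conj d).
Proof. by rewrite tr_diag_mx map_diag_mx. Qed.

(** The witness is [T^-1 e_k]. Any property of the form on nonzero vectors thus passes to the
    coefficients [d_k]: positivity for a Hermitian matrix, membership in the sector later. *)
Lemma congr_diag_coef n (T : 'M[C]_n) (d : 'rV[C]_n) k : T \in unitmx ->
  exists2 x : 'cV[C]_n, x != 0 &
    (x^t* *m (T^t* *m diag_mx d *m T) *m x) 0 0 = d 0 k.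
Proof.
move=> Tu; have [x Tx] : exists x, T *m x = delta_mx k (0 : 'I_1).
  by exists (invmx T *m delta_mx k 0); rewrite mulmxA mulmxV // mul1mx.
exists x.
  apply/eqP => x0; move/matrixP: Tx => /(_ k 0).
  by rewrite x0 mulmx0 !mxE !eqxx => /esym/eqP; rewrite oner_eq0.
rewrite !mulmxA -trmxC_mul -[_ *m T *m x]mulmxA Tx trmx_delta map_delta_mx -rowE -colE.
by rewrite !mxE eqxx mulr1n.
Qed.

(** By the spectral theorem [H = P^* diag(l) P] with [P] unitary; the [l_k] are values of the form,
    hence positive, and [S = diag(sqrt l) P]. *)
Lemma posdef_factor n (H : 'M[C]_n) :
  H^t* = H ->
  (forall x : 'cV[C]_n, x != 0 -> 0 < (x^t* *m H *m x) 0 0) ->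
  exists2 S, S \in unitmx & H = S^t* *m S.
Proof.
move=> Hherm Hpos; have Hn : H \is normalmx by apply/normalmxP; rewrite Hherm.
set P := spectralmx H; set l := spectral_diag H.
have Pu : P \is unitarymx by apply: spectral_unitarymx.
have HE : H = P^t* *m diag_mx l *m P.
  by rewrite -invmx_unitary //; exact/orthomx_spectralP.
have lgt0 k : 0 < l 0 k.
  have [x x0 <-] := congr_diag_coef l k (unitarymx_unit Pu).
  by rewrite -HE; exact: Hpos.
exists (diag_mx (map_mx sqrtC l) *m P).
  rewrite unitmx_mul (unitarymx_unit Pu) andbT unitmxE det_diag unitfE.
  by apply/prodf_neq0 => i _; rewrite mxE sqrtC_eq0 gt_eqF.
rewrite trmxC_mul trmxC_diag !mulmxA -(mulmxA (P^t*)) mulmx_diag {1}HE.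
congr (_ *m diag_mx _ *m _); apply/rowP => k; rewrite !mxE.
(* The adjoint conjugates the square roots; they are real, so each product is [l_k]. *)
have /CrealP -> : sqrtC (l 0 k) \is Num.real.
  by rewrite ger0_real // sqrtC_ge0 ltW.
by rewrite -expr2 sqrtCK.
Qed.

(* If [X + X^*] is [S^* S], then [M := S^-* X S^-1] satisfies [M + M^* = 1],
   hence is normal and the spectral theorem applies to it. *)
Lemma accretive_congr_diag n (X : 'M[C]_n) :
  (forall x : 'cV[C]_n, x != 0 -> 0 < 'Re ((x^t* *m X *m x) 0 0)) ->
  exists T d, T \in unitmx /\ X = T^t* *m diag_mx d *m T.
Proof.
move=> Xpos; have [||S Su SE] := @posdef_factor _ (X + X^t*).
- by rewrite trmxCD trmxCK addrC.
(* The form of [X + X^*] is twice the real part of the form of [X]. *)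
- move=> x /Xpos; have -> : x^t* *m (X + X^t*) *m x =
      x^t* *m X *m x + (x^t* *m X *m x)^t*.
    by rewrite !trmxC_mul trmxCK mulmxDr mulmxDl mulmxA.
  rewrite ReE => h; rewrite !mxE.
  by move: h; rewrite !mxE pmulr_lgt0 ?invr_gt0 ?ltr0n.
set V := invmx S; set M := V^t* *m X *m V.
have SV : S *m V = 1%:M by rewrite mulmxV.
have VS : V *m S = 1%:M by rewrite mulVmx.
have MM : M + M^t* = 1%:M.
  rewrite /M !trmxC_mul trmxCK mulmxA -mulmxDl -mulmxDr SE.
  by rewrite !mulmxA -trmxC_mul SV trmxC1 mul1mx.
have Mn : M \is normalmx.
  apply/normalmxP; have -> : M^t* = 1%:M - M by rewrite -MM addrC addKr.
  by rewrite mulmxBr mulmxBl mulmx1 mul1mx.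
have ME := orthomx_spectralP Mn.
rewrite invmx_unitary ?spectral_unitarymx // in ME.
exists (spectralmx M *m S), (spectral_diag M); split.
  by rewrite unitmx_mul Su spectral_unit.
transitivity (S^t* *m M *m S); last by rewrite {1}ME trmxC_mul !mulmxA.
by rewrite /M !mulmxA -trmxC_mul VS trmxC1 mul1mx -mulmxA VS mulmx1.
Qed.

End Congruence.

(** * Modulus, secant and sector *)

Section NumericalRadius.
Context {R : realType}.
Implicit Types (a : R) (z : R[i]).

Lemma normE z : `|z| = (cmod z)%:C%C.
Proof. by case: z. Qed.

Lemma cmod_ge0 z : 0 <= cmod z.
Proof. by case: z => x y; rewrite sqrtr_ge0. Qed.

Lemma cmod_sum I (r : seq I) (P : pred I) (F : I -> R[i]) :
  cmod (\sum_(i <- r | P i) F i) <= \sum_(i <- r | P i) cmod (F i).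
Proof.
by rewrite -lecR -normE rmorph_sum (le_trans (ler_norm_sum _ _ _)).
Qed.

Lemma Re_le_cmod z : complex.Re z <= cmod z.
Proof.
rewrite -lecR -normE (le_trans _ (normc_ge_Re z))// lecR.
exact: ler_norm.
Qed.

Lemma cos_gt0_acute a : 0 <= a < pi / 2 -> 0 < cos a.
Proof.
move=> /andP[a0 api]; apply: cos_gt0_pihalf; rewrite api andbT.
by rewrite (lt_le_trans _ a0)// oppr_lt0 divr_gt0 ?pi_gt0.
Qed.

Lemma sec_ge1 a : 0 <= a < pi / 2 -> 1 <= sec a.
Proof. by move=> /cos_gt0_acute ca; rewrite invf_ge1 ?cos_le1. Qed.

(** For [z = x + iy], [x^2 + y^2 <= (1 + tan^2 a) x^2 = (sec a * x)^2]. This is the source of the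
    secant factor. *)
Lemma cmod_sector a z : 0 <= a < pi / 2 -> sector a z ->
  cmod z <= sec a * complex.Re z.
Proof.
move=> /cos_gt0_acute ca [z0 zt].
have sec0 : 0 <= sec a * complex.Re z by rewrite mulr_ge0// ?invr_ge0; exact: ltW.
rewrite -(ger0_norm sec0) -sqrtr_sqr; case: z z0 zt {sec0} => x y /= x0 yt.
apply: ler_wsqrtr; rewrite exprMn /sec exprVn cos2_tan2 ?gt_eqF//.
rewrite mulrDl mul1r lerD2l -exprMn -[y ^+ 2]real_normK ?num_real//.
by rewrite lerXn2r// nnegrE (le_trans _ yt).
Qed.

(** * Quadratic form and numerical radius *)

Lemma innerE n (X : 'M[R[i]]_n) (x : 'cV[R[i]]_n) :
  inner (X *m x) x = (x^t* *m X *m x) 0 0.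
Proof.
rewrite -mulmxA mxE; apply: eq_bigr => i _.
by rewrite !mxE mulrC.
Qed.

Lemma inner_sumE n (X : 'M[R[i]]_n) (x : 'cV[R[i]]_n) :
  inner (X *m x) x = \sum_i \sum_j X i j * x j 0 * (x i 0)^*.
Proof. by apply: eq_bigr => i _; rewrite mxE mulr_suml. Qed.

Lemma enorm_sqr n (x : 'cV[R[i]]_n) :
  enorm x ^+ 2 = \sum_i cmod (x i 0) ^+ 2.
Proof. by rewrite sqr_sqrtr // sumr_ge0 // => i _; rewrite sqr_ge0. Qed.

Lemma enorm_gt0 n (x : 'cV[R[i]]_n) : x != 0 -> 0 < enorm x.
Proof.
move=> x0; rewrite lt_def sqrtr_ge0 andbT; apply: contra x0 => /eqP e0.
have /eqP := enorm_sqr x; rewrite e0 expr0n /= eq_sym psumr_eq0; last first.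
  by move=> i _; rewrite sqr_ge0.
move=> /allP x0; apply/eqP/matrixP => i j; rewrite ord1 mxE.
apply: Normc.eq0_normc; apply/eqP.
by have /(_ (mem_index_enum _)) := x0 i; rewrite sqrf_eq0.
Qed.

Lemma enormZ n (c : R) (x : 'cV[R[i]]_n) :
  enorm (c%:C%C *: x) = `|c| * enorm x.
Proof.
rewrite -[`|c|]sqrtr_sqr -sqrtrM ?sqr_ge0// mulr_sumr; congr Num.sqrt.
apply: eq_bigr => i _; rewrite mxE Normc.normcM exprMn; congr (_ * _).
by rewrite /= expr0n addr0 sqr_sqrtr // sqr_ge0.
Qed.

Lemma innerZ n (X : 'M[R[i]]_n) (c : R) (x : 'cV[R[i]]_n) :
  inner (X *m (c%:C%C *: x)) (c%:C%C *: x) = (c ^+ 2)%:C%C * inner (X *m x) x.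
Proof.
rewrite -scalemxAr /inner mulr_sumr; apply: eq_bigr => i _.
have cE w : (c%:C%C * w : R[i])^* = c%:C%C * w^*.
  by rewrite rmorphM; congr (_ * _); exact: conjc_real.
by rewrite !mxE cE mulrACA expr2 rmorphM.
Qed.

(** Normalising [x] extends facts about the numerical range from unit vectors to all nonzero
    ones. *)
Lemma numrange_homogeneous n (X : 'M[R[i]]_n) (x : 'cV[R[i]]_n) : x != 0 ->
  exists2 w, numrange X w & inner (X *m x) x = (enorm x ^+ 2)%:C%C * w.
Proof.
move=> /enorm_gt0 x0; exists (inner (X *m ((enorm x)^-1%:C%C *: x))
    ((enorm x)^-1%:C%C *: x)).
  by exists ((enorm x)^-1%:C%C *: x) => //; rewrite enormZ gtr0_norm ?invr_gt0//
    mulVf // gt_eqF.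
rewrite innerZ mulrA -rmorphM -exprMn divff ?gt_eqF//.
by rewrite expr1n mul1r.
Qed.

(** The sector is a cone, stable under multiplication by [enorm x ^+ 2 > 0]. *)
Lemma sector_inner n a (X : 'M[R[i]]_n) (x : 'cV[R[i]]_n) :
  (numrange X `<=` sector a)%classic -> x != 0 -> sector a (inner (X *m x) x).
Proof.
move=> Xa x0; have [[u v] /Xa [/= u0 vt] ->] := numrange_homogeneous X x0.
have e0 : 0 < enorm x ^+ 2 by rewrite exprn_gt0 ?enorm_gt0.
rewrite /sector /= !mul0r subr0 addr0; split; first exact: mulr_gt0.
by rewrite normrM (gtr0_norm e0) mulrCA ler_pM2l.
Qed.

(** This makes [sup] a genuine least upper bound rather than its default 0. The entries of a unit
    vector have modulus at most 1, so the sum of the moduli of the entries of [X] bounds the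
    range. *)
Lemma has_sup_numradius n (X : 'M[R[i]]_n) : (0 < n)%N ->
  has_sup [set cmod z | z in numrange X]%classic.
Proof.
move=> n0; split.
  pose x : 'cV[R[i]]_n := delta_mx (Ordinal n0) 0.
  have x0 : x != 0.
    apply/negP => /eqP/matrixP/(_ (Ordinal n0) 0); rewrite !mxE !eqxx.
    by move/eqP; rewrite oner_eq0.
  by have [w wX _] := numrange_homogeneous X x0; exists (cmod w), w.
exists (\sum_i \sum_j cmod (X i j)) => _ [_ [x x1 ->] <-].
have xle i : cmod (x i 0) <= 1.
  rewrite -(@expr_le1 _ 2)// ?cmod_ge0// -[leRHS](expr1n _ 2) -x1 enorm_sqr.
  by rewrite (bigD1 i)//= lerDl sumr_ge0 // => j _; rewrite sqr_ge0.
rewrite inner_sumE (le_trans (cmod_sum _ _ _))//; apply: ler_sum => i _.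
rewrite (le_trans (cmod_sum _ _ _))//; apply: ler_sum => j _.
have cJ z : cmod z^* = cmod z.
  by apply: complexI; rewrite -!normE normcJ.
by rewrite !Normc.normcM cJ -mulrA ler_piMr ?cmod_ge0// mulr_ile1 ?cmod_ge0//.
Qed.

(** The zero vector is included because the lemma is applied to the [u_k], some of which may
    vanish. *)
Lemma cmod_inner_le n (X : 'M[R[i]]_n) (x : 'cV[R[i]]_n) : (0 < n)%N ->
  cmod (inner (X *m x) x) <= numradius X * \sum_i cmod (x i 0) ^+ 2.
Proof.
move=> n0; have [->|x0] := eqVneq x 0.
  rewrite mulmx0 /inner !big1 ?Normc.normc0 ?mulr0// => i _.
    by rewrite mxE Normc.normc0 expr0n.
  by rewrite mxE mul0r.
have [w wX ->] := numrange_homogeneous X x0.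
rewrite -enorm_sqr Normc.normcM mulrC.
have -> : cmod (enorm x ^+ 2)%:C%C = enorm x ^+ 2.
  by rewrite /= expr0n addr0 sqrtr_sqr ger0_norm ?sqr_ge0.
rewrite ler_pM2r ?exprn_gt0 ?enorm_gt0//.
by apply: (sup_upper_bound (has_sup_numradius X n0)); exists w.
Qed.

Lemma numradius_ge0 n (X : 'M[R[i]]_n) : (0 < n)%N -> 0 <= numradius X.
Proof.
move=> n0; have [[t Xt] _] := has_sup_numradius X n0.
apply: (@le_trans _ _ t); first by case: Xt => z _ <-; exact: cmod_ge0.
exact: (sup_upper_bound (has_sup_numradius X n0)).
Qed.

(** * Diagonal entries and the Hadamard product *)

Lemma cmod_diag_le n (X : 'M[R[i]]_n) i : cmod (X i i) <= maxdiag X.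
Proof. exact: (le_bigmax_cond _ (fun j => cmod (X j j))). Qed.

Lemma maxdiag_ge0 n (X : 'M[R[i]]_n) : 0 <= maxdiag X.
Proof. exact: bigmax_ge_id. Qed.

Lemma sector_congr_diag n a (X : 'M[R[i]]_n) :
  (numrange X `<=` sector a)%classic ->
  exists (T : 'M[R[i]]_n) (d : 'rV[R[i]]_n),
    (forall k, sector a (d 0 k)) /\ X = T^t* *m diag_mx d *m T.
Proof.
move=> Xa; have [|T [d [Tu XE]]] := accretive_congr_diag (X := X).
  move=> x x0; rewrite -innerE -complexRe ltcR.
  by have [] := sector_inner Xa x0.
exists T, d; split=> // k; have [x x0 <-] := congr_diag_coef d k Tu.
by rewrite -XE -innerE; exact: sector_inner.
Qed.

(** Expand [z x_ij = sum_k d_k T_kj (T_ki)^*], then absorb [T_kj] into [x_j] and its conjugate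
    counterpart into [(x_i)^*]. *)
Lemma hadamard_inner n (X Y : 'M[R[i]]_n) (x : 'cV[R[i]]_n) z
    (T : 'M[R[i]]_n) (d : 'rV[R[i]]_n) (u := fun k => \col_j (T k j * x j 0)) :
  z *: X = T^t* *m diag_mx d *m T ->
  z * inner (hadamard X Y *m x) x = \sum_k d 0 k * inner (Y *m u k) (u k).
Proof.
move=> XE; rewrite inner_sumE mulr_sumr.
under eq_bigr => i _.
  rewrite mulr_sumr.
  under eq_bigr => j _.
    rewrite mxE !mulrA.
    have -> : z * X i j = (z *: X) i j by rewrite mxE.
    rewrite XE mulmx_diagE !mulr_suml.
    over.
  rewrite exchange_big.
  over.
rewrite exchange_big; apply: eq_bigr => k _ /=.
rewrite inner_sumE mulr_sumr; apply: eq_bigr => i _.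
rewrite mulr_sumr; apply: eq_bigr => j _.
rewrite !mxE rmorphM /=; ring.
Qed.

(** The diagonal entry is [sum_k d_k |T_kj|^2], whose weights are real. Read backwards, this turns
    the sum over [k] into a diagonal entry. *)
Lemma Re_congr_diag n (X : 'M[R[i]]_n) (T : 'M[R[i]]_n) (d : 'rV[R[i]]_n) j :
  X = T^t* *m diag_mx d *m T ->
  complex.Re (X j j) = \sum_k complex.Re (d 0 k) * cmod (T k j) ^+ 2.
Proof.
move=> ->; rewrite mulmx_diagE raddf_sum; apply: eq_bigr => k _.
rewrite -mulrA -normCK normE -rmorphXn /=.
by case: (d 0 k) => p q /=; rewrite mulr0 subr0.
Qed.

(** One-sided estimate with a single secant, to be used twice with the factors exchanged. *)
Lemma numradius_hadamard_le n a (X Y : 'M[R[i]]_n) :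
  (0 < n)%N -> 0 <= a < pi / 2 -> sectorial n a X ->
  numradius (hadamard X Y) <= sec a * (maxdiag X * numradius Y).
Proof.
move=> n0 ha [z z1 /sector_congr_diag [T [d [dS XE]]]].
apply: ge_sup; first by have [] := has_sup_numradius (hadamard X Y) n0.
move=> _ [_ [x x1 ->] <-].
(* Since [|z| = 1], the rotation by [z] is inserted at no cost. *)
rewrite -[leLHS]mul1r -z1 -Normc.normcM (hadamard_inner Y x XE).
have seca : 0 <= sec a by rewrite (le_trans ler01)// sec_ge1.
rewrite (le_trans (cmod_sum _ _ _))//.
(* Termwise, [|d_k| <= sec(a) Re d_k] and [|<Y u_k, u_k>| <= w(Y) |u_k|^2]. *)
apply: (@le_trans _ _ (\sum_k sec a * complex.Re (d 0 k) *
    (numradius Y * \sum_j cmod (T k j) ^+ 2 * cmod (x j 0) ^+ 2))).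
  apply: ler_sum => k _; rewrite Normc.normcM.
  apply: ler_pM; rewrite ?cmod_ge0 ?cmod_sector//.
  rewrite (le_trans (cmod_inner_le _ _ n0))// ler_wpM2l ?numradius_ge0//.
  by apply: ler_sum => j _; rewrite mxE Normc.normcM exprMn.
(* Exchanging the sums gathers [sum_k Re(d_k) |T_kj|^2 = Re(z x_jj)]. *)
have -> : \sum_k sec a * complex.Re (d 0 k) *
    (numradius Y * \sum_j cmod (T k j) ^+ 2 * cmod (x j 0) ^+ 2) =
    sec a * (numradius Y *
      \sum_j complex.Re ((z *: X) j j) * cmod (x j 0) ^+ 2).
  under [in RHS]eq_bigr => j _ do rewrite (Re_congr_diag _ XE) mulr_suml.
  rewrite exchange_big !mulr_sumr; apply: eq_bigr => k _ /=.
  rewrite !mulr_sumr; apply: eq_bigr => j _; ring.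
rewrite ler_wpM2l// mulrC ler_wpM2r ?numradius_ge0//.
(* Replacing 1 by [enorm x ^+ 2] spreads [maxdiag X] over the coordinates, where
   [Re(z x_jj) <= |z x_jj| = |x_jj|]. *)
rewrite -[maxdiag X]mulr1 -(expr1n _ 2) -x1 enorm_sqr mulr_sumr.
apply: ler_sum => j _; rewrite ler_wpM2r ?sqr_ge0//.
rewrite (le_trans (Re_le_cmod _))// mxE Normc.normcM z1 mul1r.
exact: cmod_diag_le.
Qed.

Lemma hadamardC n (X Y : 'M[R[i]]_n) : hadamard X Y = hadamard Y X.
Proof. by apply/matrixP => i j; rewrite !mxE mulrC. Qed.

End NumericalRadius.

Theorem theorem2p5 (R : realType) (n : nat) (a1 a2 : R) (X Y : 'M[R[i]]_n) :
  (0 < n)%N ->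
  0 <= a1 < pi / 2 ->
  0 <= a2 < pi / 2 ->
  sectorial n a1 X ->
  sectorial n a2 Y ->
  numradius (hadamard X Y) <=
    sec a1 * sec a2 *
      Num.min (maxdiag X * numradius Y) (maxdiag Y * numradius X).
Proof.
move=> n0 ha1 ha2 hX hY.
have XY := numradius_hadamard_le Y n0 ha1 hX.
have := numradius_hadamard_le X n0 ha2 hY; rewrite hadamardC => YX.
have s1 := sec_ge1 ha1; have s2 := sec_ge1 ha2.
have [m1 m2] : 0 <= maxdiag X * numradius Y /\ 0 <= maxdiag Y * numradius X.
  by rewrite !mulr_ge0 ?maxdiag_ge0 ?numradius_ge0.
(* Whichever term is the minimum, its one-secant bound is weakened by the other secant, at least 1,
   times a nonnegative quantity. *)
rewrite minEle; case: ifP => _.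
  apply: (le_trans XY); rewrite -mulrA ler_wpM2l ?(le_trans ler01)//.
  by rewrite ler_peMl.
apply: (le_trans YX); rewrite [sec a1 * _]mulrC -mulrA.
by rewrite ler_wpM2l ?(le_trans ler01)// ler_peMl.
Qed.
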